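(* Let $S\subseteq\{0,1\}^n$ be a cube-ideal set-system with connectivity at least $2$. Then $\mathrm{core}(S)$ is also cube-ideal.
   Context: A set-system is a subset $S\subseteq\{0,1\}^n$ with convex hull $\mathrm{conv}(S)$. A GSC inequality is $\sum_{i\in I}x_i+\sum_{j\in J}(1-x_j)\geq1$ for disjoint $I,J\subseteq[n]$, using $|I|+|J|$ variables; a $2$-GSC inequality uses exactly $2$ variables; capacity inequalities are $x_i\geq0$, $x_i\leq1$. $S$ is cube-ideal if $\mathrm{conv}(S)$ is the solution set of a finite family of capacity and GSC inequalities. The connectivity of $S$ is the minimum number of variables in a GSC inequality valid for $\mathrm{conv}(S)$ ($+\infty$ if $S=\{0,1\}^n$). $\mathrm{core}(S)$ is the set of points of $S$ that satisfy every $2$-GSC inequality valid for $\mathrm{conv}(S)$ with equality. *)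

(* Defs.v *)
From HB Require Import structures.
From mathcomp Require Import all_boot all_order all_algebra.
From mathcomp Require Import boolp classical_sets reals constructive_ereal.

Set Implicit Arguments.
Unset Strict Implicit.
Unset Printing Implicit Defensive.

Import Order.TTheory GRing.Theory Num.Theory.

Local Open Scope classical_set_scope.
Local Open Scope ring_scope.

Definition hypercube (R : realType) (n : nat) : set 'rV[R]_n :=
  [set x | forall i, x 0 i = 0 \/ x 0 i = 1].

Definition conv_hull (R : realType) (n : nat) (S : set 'rV[R]_n) :
    set 'rV[R]_n :=
  [set x | exists (m : nat) (p : 'I_m -> 'rV[R]_n) (w : 'I_m -> R),
     [/\ forall k, S (p k), forall k, 0 <= w k, \sum_k w k = 1
       & x = \sum_k w k *: p k]].

(* The GSC inequality of a disjoint pair (I, J); it is the inequality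
   gsc_lhs c x >= 1. I and J may be empty, even simultaneously. *)
Definition gsc (n : nat) : Type :=
  {IJ : {set 'I_n} * {set 'I_n} | [disjoint IJ.1 & IJ.2]%B}.

Definition gsc_lhs (R : realType) (n : nat) (c : gsc n) (x : 'rV[R]_n) : R :=
  \sum_(i in (val c).1) x 0 i + \sum_(j in (val c).2) (1 - x 0 j).

Definition gsc_nvars (n : nat) (c : gsc n) : nat :=
  (#|(val c).1| + #|(val c).2|)%N.

Definition gsc_valid (R : realType) (n : nat) (S : set 'rV[R]_n) (c : gsc n) :
    Prop :=
  forall x, conv_hull S x -> 1 <= gsc_lhs c x.

Variant ineq (n : nat) : Type :=
  | CapGe0 of 'I_n
  | CapLe1 of 'I_n
  | Gsc of gsc n.

Definition sat (R : realType) (n : nat) (x : 'rV[R]_n) (e : ineq n) : bool :=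
  match e with
  | CapGe0 i => 0 <= x 0 i
  | CapLe1 i => x 0 i <= 1
  | Gsc c => 1 <= gsc_lhs c x
  end.

Definition cube_ideal (R : realType) (n : nat) (S : set 'rV[R]_n) : Prop :=
  exists F : seq (ineq n), conv_hull S = [set x | all (sat x) F].

(* The default value +oo is attained exactly when no GSC inequality is valid,
   i.e. when S is the whole hypercube. *)
Definition connectivity (R : realType) (n : nat) (S : set 'rV[R]_n) : \bar R :=
  \big[Order.min/+oo%E]_(c : gsc n | `[< gsc_valid S c >])
    ((gsc_nvars c)%:R%:E).

Definition core (R : realType) (n : nat) (S : set 'rV[R]_n) : set 'rV[R]_n :=
  [set x | S x /\
     forall c : gsc n, gsc_nvars c = 2%N -> gsc_valid S c -> gsc_lhs c x = 1].

(* Main.v *)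
Require Import Defs.
From HB Require Import structures.
From mathcomp Require Import all_boot all_order all_algebra.
From mathcomp Require Import boolp classical_sets reals constructive_ereal.

(** Each valid 2-GSC inequality, taken with equality, cuts out a face of
    conv(S), so conv(core(S)) is conv(S) intersected with these equalities.
    Exchanging I and J in a GSC inequality in k variables turns its left-hand
    side L into k - L; hence for k = 2 the reverse inequality L <= 1 is again
    a GSC inequality, and each equality is a pair of GSC inequalities. *)

Import Order.TTheory GRing.Theory Num.Theory.

Local Open Scope classical_set_scope.
Local Open Scope ring_scope.

Lemma sub_conv_hull (R : realType) (n : nat) (S : set 'rV[R]_n) :
  S `<=` conv_hull S.
Proof.
move=> x Sx; exists 1%N, (fun=> x), (fun=> 1).
by split=> //; rewrite big_ord1 ?scale1r.
Qed.

Lemma conv_hull_subset (R : realType) (n : nat) (S T : set 'rV[R]_n) :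
  S `<=` T -> conv_hull S `<=` conv_hull T.
Proof.
move=> ST x [m [p [w [Sp w0 w1 ->]]]]; exists m, p, w; split=> // k.
exact: ST.
Qed.

(** [gsc_lhs c] is affine rather than linear: the constants in the terms [1 - x 0 j] are what calls
    for weights summing to 1. *)
Lemma gsc_lhs_sum (R : realType) (n m : nat) (c : gsc n)
    (p : 'I_m -> 'rV[R]_n) (w : 'I_m -> R) :
  \sum_k w k = 1 ->
  gsc_lhs c (\sum_k w k *: p k) = \sum_k w k * gsc_lhs c (p k).
Proof.
move=> w1; have coord i : (\sum_k w k *: p k) 0 i = \sum_k w k * p k 0 i.
  by rewrite summxE; apply: eq_bigr => k _; rewrite mxE.
rewrite /gsc_lhs; under [RHS]eq_bigr do rewrite mulrDr !mulr_sumr.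
rewrite [RHS]big_split /=; congr (_ + _); rewrite [RHS]exchange_big /=.
  by apply: eq_bigr => i _; rewrite coord.
apply: eq_bigr => j _; rewrite coord -{1}w1 -sumrB.
by apply: eq_bigr => k _; rewrite mulrBr mulr1.
Qed.

(** A weighted average of values that are all at least 1 can equal 1 only if every value of nonzero
    weight is 1. So a convex combination lying on the face uses, up to zero weights, only points of
    the face. *)
Lemma conv_hull_face (R : realType) (n : nat) (S : set 'rV[R]_n)
    (C : set (gsc n)) :
  C `<=` gsc_valid S ->
  conv_hull [set x | S x /\ forall c, C c -> gsc_lhs c x = 1] =
  [set x | conv_hull S x /\ forall c, C c -> gsc_lhs c x = 1].
Proof.
move=> Cvalid; apply/seteqP; split=> x /=.
  move=> xT; split; first by apply: conv_hull_subset xT => y [].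
  move: xT => [m [p [w [Tp w0 w1 ->]]]] c Cc; rewrite gsc_lhs_sum // -[RHS]w1.
  by apply: eq_bigr => k _; have [_ ->] := Tp k; rewrite ?mulr1.
move=> [[m [p [w [Sp w0 w1 xE]]]] xC].
have pC k c : w k != 0 -> C c -> gsc_lhs c (p k) = 1.
  move=> wk0 Cc.
  (* The weighted slacks are nonnegative and add up to [gsc_lhs c x - 1 = 0], so each of them
     vanishes. *)
  have ge0 i : 0 <= w i * (gsc_lhs c (p i) - 1).
    rewrite mulr_ge0 // subr_ge0; apply: Cvalid => //.
    exact: sub_conv_hull.
  have sum0 : \sum_i w i * (gsc_lhs c (p i) - 1) = 0.
    under eq_bigr do rewrite mulrBr mulr1.
    by rewrite sumrB -gsc_lhs_sum // -xE xC // w1 subrr.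
  have /eqP : w k * (gsc_lhs c (p k) - 1) = 0 by apply: psumr_eq0P sum0 _ _.
  by rewrite mulf_eq0 (negPf wk0) subr_eq0 => /eqP.
have [k0 wk0] : exists k0, w k0 != 0.
  apply/existsP; apply: contraT; rewrite negb_exists => /forallP w_eq0.
  move: w1; rewrite big1 => [/eqP|k _]; first by rewrite eq_sym oner_eq0.
  by apply/eqP; rewrite -[_ == _]negbK.
(* Points of weight zero may lie off the face; replacing them by [p k0], which lies on it, leaves
   the combination unchanged. *)
exists m, (fun k => if w k == 0 then p k0 else p k), w; split=> //.
  by move=> k; case: eqVneq => [_|wk]; split=> // c Cc; apply: pC.
rewrite xE; apply: eq_bigr => k _.
by case: eqVneq => [->|//]; rewrite !scale0r.
Qed.

Lemma gsc_swap_disjoint (n : nat) (c : gsc n) :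
  [disjoint (val c).2 & (val c).1]%B.
Proof. by rewrite disjoint_sym; apply: (valP c). Qed.

Definition gsc_swap (n : nat) (c : gsc n) : gsc n :=
  exist _ ((val c).2, (val c).1) (gsc_swap_disjoint n c).

Lemma gsc_lhs_swap (R : realType) (n : nat) (c : gsc n) (x : 'rV[R]_n) :
  gsc_lhs (gsc_swap n c) x = (gsc_nvars c)%:R - gsc_lhs c x.
Proof.
apply/eqP; rewrite eq_sym subr_eq /gsc_lhs /gsc_nvars /= natrD; apply/eqP.
(* Regroup by index set: each index of I or J contributes [x 0 i] and [1 - x 0 i], hence exactly
   1. *)
rewrite [X in _ = X + _]addrC addrACA -!big_split /= -!sumr_const.
by congr (_ + _); apply: eq_bigr => i _; rewrite ?subrK // addrC subrK.
Qed.

Lemma gsc_pair_eq1 (R : realType) (n : nat) (c : gsc n) (x : 'rV[R]_n) :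
  gsc_nvars c = 2%N ->
  sat x (Gsc c) && sat x (Gsc (gsc_swap n c)) = (gsc_lhs c x == 1).
Proof.
by move=> c2; rewrite /= gsc_lhs_swap c2 lerBrDl -lerBrDr -addrA subrr addr0
  andbC -eq_le.
Qed.

Theorem theorem4p3 (R : realType) (n : nat) (S : set 'rV[R]_n)
    (S_sub : S `<=` @hypercube R n)
    (S_ideal : cube_ideal S)
    (S_conn : (2%:E <= connectivity S)%E) :
  cube_ideal (core S).
Proof.
have [F SF] := S_ideal.
pose C : set (gsc n) := [set c | gsc_nvars c = 2%N /\ gsc_valid S c].
have -> : core S = [set x | S x /\ forall c, C c -> gsc_lhs c x = 1].
  apply/seteqP; split=> x /= [Sx xC]; split=> // c; first by case=> *; apply: xC.
  by move=> *; apply: xC.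
(* [gsc n] is a finite type, so the equalities defining the face fit in a finite list. *)
pose D := [seq c <- enum {: gsc n} | `[< C c >]].
exists (F ++ map (@Gsc n) D ++ map (fun c => Gsc (gsc_swap n c)) D).
rewrite conv_hull_face; last by move=> c [].
(* [all_predI] fuses the two passes over [D], so that each [c] meets its swap as in
   [gsc_pair_eq1]. *)
rewrite SF; apply/seteqP; split=> x /=; rewrite !all_cat !all_map -all_predI.
  move=> [-> xC] /=; apply/allP => c; rewrite mem_filter => /andP[/asboolP Cc _].
  by apply/idP; rewrite [X in is_true X]gsc_pair_eq1 ?xC //; case: Cc.
move=> /andP[-> /allP xD]; split=> // c Cc; apply/eqP.
rewrite -gsc_pair_eq1; last by case: Cc.
by apply: xD; rewrite mem_filter mem_enum andbT; apply/asboolP.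
Qed.
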